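(* Let $f,g:Q\to\mathbb{R}$ be convex functions, $M_f>0$, $M_g>0$, and let $\varepsilon>0$, $\delta>0$ be fixed positive numbers, such that for all $x,y\in Q$ $$f(x)+\psi_f(y,x)\le f(y),\qquad -\psi_f(y,x)\le M_f\sqrt{2V_d(y,x)}+\delta,$$ $$g(x)+\psi_g(y,x)\le g(y),\qquad -\psi_g(y,x)\le M_g\sqrt{2V_d(y,x)}+\delta,$$ where $\psi_f(y,x),\psi_g(y,x)$ are convex in $y$ and $\psi_f(x,x)=\psi_g(x,x)=0$ for every $x\in Q$. Let $x^*$ be a solution of $\min\{f(x):x\in Q,\ g(x)\le 0\}$ and let $\Theta_0>0$ be a known constant such that $d(x^* )\le\Theta_0^2$. Then, after the stopping of Algorithm C (described in the context), its output $\widehat{x}$ satisfies $$f(\widehat{x})-f(x^* )\le\varepsilon+\delta\quad\text{and}\quad g(\widehat{x})\le\varepsilon+\delta.$$ Moreover, the required number of iterations of Algorithm C does not exceed $$N=\frac{2M^2\Theta_0^2}{\varepsilon^2},\qquad\text{where } M=\max\{M_f,M_g\}.$$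
   Context: $(E,\|\cdot\|)$ is a finite-dimensional normed space, $Q\subset E$ is a closed convex set, and $f,g:Q\to\mathbb{R}$ are subdifferentiable. The reference function $d:Q\to\mathbb{R}$ is any convex (not necessarily strongly convex) differentiable function. The Bregman divergence is $V_d(y,x)=d(y)-d(x)-\langle\nabla d(x),y-x\rangle$ for $x,y\in Q$. Proximal mapping: for $h>0$, $\mathrm{Mirr}_h(x,\psi)=\arg\min_{y\in Q}\{\psi(y,x)+\frac1h V_d(y,x)\}$. Algorithm C. Input: $\varepsilon>0$, $\delta>0$, $M_f>0$, $M_g>0$, $\Theta_0$ with $d(x^* )\le\Theta_0^2$. Start from $x^0=\arg\min_{x\in Q}d(x)$, $I=J=\emptyset$, $N=0$. Repeat: if $g(x^N)\le\varepsilon+\delta$, set $h^f=\frac{\varepsilon}{M_f^2}$, $x^{N+1}=\mathrm{Mirr}_{h^f}(x^N,\psi_f)$ and add $N$ to $I$ (productive step); otherwise set $h^g=\frac{\varepsilon}{M_g^2}$, $x^{N+1}=\mathrm{Mirr}_{h^g}(x^N,\psi_g)$ and add $N$ to $J$ (non-productive step); then increase $N$ by 1; until $$\frac{2\Theta_0^2}{\varepsilon^2}\le\frac{|I|}{M_f^2}+\frac{|J|}{M_g^2}.$$ Output $\widehat{x}=\frac1{|I|}\sum_{k\in I}x^k$.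
   Formalization: The reference function d is additionally assumed nonnegative on Q (otherwise d(x* ) ≤ Θ_0² does not bound d(x* ) − d(x^0) and the claim fails), and the bound on the number of iterations is N rounded up to an integer, since the loop performs at least one iteration. *)

(* Defs.v *)
From HB Require Import structures.
From mathcomp Require Import all_boot all_order all_algebra.
From mathcomp Require Import all_classical all_reals all_analysis.

Set Implicit Arguments.
Unset Strict Implicit.
Unset Printing Implicit Defensive.

Import Order.TTheory GRing.Theory Num.Theory.
Import numFieldNormedType.Exports.

Local Open Scope classical_set_scope.
Local Open Scope ring_scope.

(* A function Q -> R is represented by a total function E -> R of which only
   the values on Q are ever used. *)

Definition finite_dimensional (R : realType) (E : normedModType R) : Prop :=
  exists (n : nat) (v2r : {linear E -> 'rV[R]_n}), bijective v2r.

Definition subdifferentiable (R : realType) (E : normedModType R)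
    (Q : set E) (f : E -> R) : Prop :=
  forall x, Q x ->
    exists p : {scalar E}, forall y, Q y -> f x + p (y - x) <= f y.

(* Differentiability at x relative to Q: no extension of d to a neighbourhood
   of Q is assumed, and Q may have empty interior.  The functional l need not
   be unique then, but the values l (y - x) for y in the convex set Q are. *)
Definition is_gradient (R : realType) (E : normedModType R)
    (Q : set E) (d : E -> R) (x : E) (l : {scalar E}) : Prop :=
  (fun y => d y - d x - l (y - x) : R^o) =o_ (within Q (nbhs x))
  (fun y => y - x).

Definition argmin (R : realType) (E : normedModType R)
    (Q : set E) (F : E -> R) : set E :=
  [set y | Q y /\ forall z, Q z -> F y <= F z].

Definition bregman (R : realType) (E : normedModType R)
    (d : E -> R) (nabla_d : E -> {scalar E}) (y x : E) : R :=
  d y - d x - nabla_d x (y - x).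

(* The set of all minimizers: d is not assumed strongly convex, so the
   minimizer need not be unique. *)
Definition Mirr (R : realType) (E : normedModType R) (Q : set E)
    (d : E -> R) (nabla_d : E -> {scalar E})
    (h : R) (x : E) (psi : E -> E -> R) : set E :=
  argmin Q (fun y => psi y x + h^-1 * bregman d nabla_d y x).

Record algC_data (R : realType) (E : normedModType R) := AlgCData {
  dom : set E;
  constr : E -> R;
  ref : E -> R;
  grad_ref : E -> {scalar E};
  psif : E -> E -> R;
  psig : E -> E -> R;
  Mf : R;
  Mg : R;
  eps : R;
  delta : R;
  Theta0 : R
}.

(* I and J after the first n iterations along the iterates x 0, x 1, ... *)
Definition algC_I (R : realType) (E : normedModType R) (A : algC_data E)
    (x : nat -> E) (n : nat) : {set 'I_n} :=
  [set k : 'I_n | constr A (x k) <= eps A + delta A]%SET.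

Definition algC_J (R : realType) (E : normedModType R) (A : algC_data E)
    (x : nat -> E) (n : nat) : {set 'I_n} :=
  (~: algC_I A x n)%SET.

Definition algC_stop (R : realType) (E : normedModType R) (A : algC_data E)
    (x : nat -> E) (n : nat) : Prop :=
  2 * Theta0 A ^+ 2 / eps A ^+ 2
    <= #|algC_I A x n|%:R / Mf A ^+ 2 + #|algC_J A x n|%:R / Mg A ^+ 2.

(* The algorithm can perform n iterations producing x 0, ..., x n (the values
   x k with n < k are irrelevant).  As a repeat-until loop it tests the
   stopping criterion after each iteration, hence never at k = 0. *)
Record algC_run (R : realType) (E : normedModType R) (A : algC_data E)
    (x : nat -> E) (n : nat) : Prop := {
  run_start : argmin (dom A) (ref A) (x 0%N);
  run_productive : forall k, (k < n)%N ->
    constr A (x k) <= eps A + delta A ->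
    Mirr (dom A) (ref A) (grad_ref A) (eps A / Mf A ^+ 2) (x k) (psif A)
      (x k.+1);
  run_nonproductive : forall k, (k < n)%N ->
    eps A + delta A < constr A (x k) ->
    Mirr (dom A) (ref A) (grad_ref A) (eps A / Mg A ^+ 2) (x k) (psig A)
      (x k.+1);
  run_continue : forall k, (0 < k < n)%N -> ~ algC_stop A x k
}.

Definition algC_stops_at (R : realType) (E : normedModType R)
    (A : algC_data E) (x : nat -> E) (n : nat) : Prop :=
  [/\ (0 < n)%N, algC_run A x n & algC_stop A x n].

Definition algC_output (R : realType) (E : normedModType R)
    (A : algC_data E) (x : nat -> E) (n : nat) : E :=
  #|algC_I A x n|%:R^-1 *: \sum_(k in algC_I A x n) x k.

(* Main.v *)
(* Minimality of the mirror step y from x, tested along the segments from y,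
   gives  h (psi(y,x) - psi(z,x)) <= <nabla d(y) - nabla d(x), z - y>, and the
   right-hand side is V(z,x) - V(y,x) - V(z,y).  The bound on - psi(y,x) and
   Young's inequality, with h = eps / M^2, turn this into
     h (- psi(z,x) - (eps/2 + delta)) <= V(z,x) - V(z,y).
   At z = xstar the left-hand side dominates h (f(x) - f(xstar) - (eps/2 + delta))
   at productive steps and h (g(x) - (eps/2 + delta)) at the others, and the sum
   telescopes to at most V(xstar,x0) <= Theta_0^2.  The stopping rule says that
   eps/2 times the sum of the step sizes is at least Theta_0^2, so eps/2 can be
   replaced by eps with right-hand side 0.  Non-productive terms are then
   positive, so some step is productive and convexity bounds f at the mean. *)
Require Import Defs.
From mathcomp Require Import all_boot all_order all_algebra.
From mathcomp Require Import all_classical all_reals all_analysis.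
From mathcomp Require Import ring lra.

Set Implicit Arguments.
Unset Strict Implicit.
Unset Printing Implicit Defensive.

Import Order.TTheory GRing.Theory Num.Theory.
Import numFieldNormedType.Exports.
Local Open Scope classical_set_scope.
Local Open Scope ring_scope.

(** * Convexity along segments and Jensen's inequality for means *)

Section ConvexLines.
Context (R : realType) (E : normedModType R) (Q : set E).

Lemma conv_segment (x z : convex_lmodType E) (t : {i01 R}) :
  conv t z x = x + t%:num *: (z - x) :> E.
Proof.
rewrite /conv /= scalerBl scale1r scalerBr.
by rewrite addrCA.
Qed.

Lemma convex_set_segment (x z : E) (t : R) :
  convex_set Q -> Q x -> Q z -> 0 <= t <= 1 -> Q (x + t *: (z - x)).
Proof.
move=> Qcvx /mem_set Qx /mem_set Qz /andP[t0 t1].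
by have /set_mem := Qcvx z x (Itv01 t0 t1) Qz Qx; rewrite conv_segment.
Qed.

Lemma convex_function_segment (f : E -> R) (x z : E) (t : R) :
  convex_function Q f -> Q x -> Q z -> 0 <= t <= 1 ->
  f (x + t *: (z - x)) <= f x + t * (f z - f x).
Proof.
move=> fcvx /mem_set Qx /mem_set Qz /andP[t0 t1].
have := fcvx (Itv01 t0 t1) z x Qz Qx; rewrite conv_segment => /le_trans; apply.
by rewrite convR_line_path /line_path /=; lra.
Qed.

(** Induction from singletons: the mean of [i :: s] lies on the segment from the mean [m] of [s] to
    [x i], at parameter [(size s).+1%:R^-1], so two-point convexity suffices. *)
Lemma convex_mean_seq (I : eqType) (f : E -> R) (x : I -> E) (s : seq I) :
  convex_set Q -> convex_function Q f ->
  s != [::] -> (forall i, i \in s -> Q (x i)) ->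
  Q ((size s)%:R^-1 *: \sum_(i <- s) x i) /\
  f ((size s)%:R^-1 *: \sum_(i <- s) x i) <=
    (size s)%:R^-1 * \sum_(i <- s) f (x i).
Proof.
move=> Qcvx fcvx; elim: s => // i [|j s] IHs _ Qx.
  by rewrite !big_seq1 invr1 scale1r mul1r; split=> //; apply: Qx; rewrite inE.
have s0 : j :: s != [::] by [].
move: (j :: s) s0 IHs Qx => {j}s s0 IHs Qx.
rewrite !big_cons /=.
have [Qm fm] := IHs s0 (fun k ks => Qx k (@mem_behead _ (i :: s) k ks)).
set m := _ *: _ in Qm fm.
have n0 : (size s)%:R != 0 :> R by rewrite pnatr_eq0 size_eq0.
have n1 : (size s).+1%:R != 0 :> R by rewrite pnatr_eq0.
have t01 : 0 <= ((size s).+1%:R^-1 : R) <= 1.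
  by rewrite invr_ge0 ler0n /= invf_le1 ?ltr0n // ler1n.
have Qi : Q (x i) by apply: Qx; rewrite mem_head.
have -> : (size s).+1%:R^-1 *: (x i + \sum_(k <- s) x k) =
    m + (size s).+1%:R^-1 *: (x i - m).
  have -> : \sum_(k <- s) x k = (size s)%:R *: m.
    by rewrite /m scalerA divff // scale1r.
  rewrite !scalerDr addrC scalerA scalerN [RHS]addrCA [RHS]addrC.
  congr (_ + _); rewrite -[X in _ = X - _]scale1r -scalerBl; congr (_ *: _).
  by field.
split; first exact: convex_set_segment.
apply: (le_trans (convex_function_segment fcvx Qm Qi t01)).
have -> : \sum_(k <- s) f (x k) =
    (size s)%:R * ((size s)%:R^-1 * \sum_(k <- s) f (x k)).
  by rewrite mulrA divff // mul1r.
move: fm; set F := _^-1 * \sum_(_ <- _) _ => fm.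
have -> : (size s).+1%:R^-1 * (f (x i) + (size s)%:R * F) =
    (1 - (size s).+1%:R^-1) * F + (size s).+1%:R^-1 * f (x i).
  by field.
have : 0 <= (1 - (size s).+1%:R^-1) * (F - f m).
  by apply: mulr_ge0; rewrite subr_ge0 //; case/andP: t01.
set T := _^-1; move: (f m) (f (x i)) => u v; lra.
Qed.

Lemma convex_mean (I : finType) (A : {set I}) (f : E -> R) (x : I -> E) :
  convex_set Q -> convex_function Q f ->
  A != finset.set0 -> (forall i, i \in A -> Q (x i)) ->
  Q (#|A|%:R^-1 *: \sum_(i in A) x i) /\
  f (#|A|%:R^-1 *: \sum_(i in A) x i) <= #|A|%:R^-1 * \sum_(i in A) f (x i).
Proof.
move=> Qcvx fcvx A0 Qx; rewrite -!big_enum cardE.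
apply: convex_mean_seq => // [|i]; last by rewrite mem_enum; exact: Qx.
by rewrite -size_eq0 -cardE cards_eq0.
Qed.

End ConvexLines.

(** * One-sided derivatives along segments of [Q] *)

Section Gradient.
Context (R : realType) (E : normedModType R) (Q : set E) (d : E -> R).

(** Convexity keeps the segment inside [Q] for small [t > 0], so the little-o relative to [Q] can be
    evaluated along it. This is how the gradient enters all later inequalities. *)
Lemma is_gradient_cvg_segment (l : {scalar E}) (x z : E) :
  convex_set Q -> is_gradient Q d x l -> Q x -> Q z ->
  t^-1 * (d (x + t *: (z - x)) - d x) @[t --> 0^'+] --> l (z - x).
Proof.
move=> Qcvx gradl Qx Qz.
have path_cvg : (x + t *: (z - x)) @[t --> (0 : R)^'+] --> within Q (nbhs x).
  move=> U /= QU.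
  have path0 : (x + t *: (z - x)) @[t --> (0 : R)^'+] --> x.
    apply: cvg_at_right_filter.
    rewrite -[X in _ --> X]addr0 -(scale0r (z - x)).
    by apply: cvgD; [exact: cvg_cst|apply: cvgZr_tmp; exact: cvg_id].
  have : \forall t \near (0 : R)^'+,
      Q (x + t *: (z - x)) -> U (x + t *: (z - x)).
    exact: path0 _ QU.
  rewrite !near_simpl => QUt; near=> t.
  have : Q (x + t *: (z - x)) -> U (x + t *: (z - x)) by near: t.
  by apply; apply: convex_set_segment => //; apply/andP; split; near: t;
    [exact: nbhs_right_ge|exact: nbhs_right_le].
apply/cvgrPdist_le => e e0.
(* The displacement has norm [t * |z - x|], so this constant leaves an error of at most [e] after
   division by [t]; the [+ 1] covers [z = x]. *)
have c0 : 0 < e / (`|z - x| + 1) by rewrite divr_gt0 // ltr_wpDl.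
have /eqoP /(_ _ c0) /path_cvg grad_near := gradl.
near=> t.
have t0 : 0 < t by near: t; exact: nbhs_right_gt.
have : `|d (x + t *: (z - x)) - d x - l (x + t *: (z - x) - x)| <=
    e / (`|z - x| + 1) * `|x + t *: (z - x) - x| by near: t.
rewrite [x + _ - x]addrAC subrr add0r linearZ /= normrZ gtr0_norm //.
set D := d _ - d x => D_le.
have -> : l (z - x) - t^-1 * D = - (t^-1 * (D - t * l (z - x))).
  by rewrite {D_le}; move: (l _) D => L D; field; rewrite gt_eqF.
rewrite normrN normrM gtr0_norm ?invr_gt0 // ler_pdivrMl //.
apply: le_trans D_le _; rewrite mulrCA ler_wpM2l ?(ltW t0) //.
rewrite -mulrA ler_piMr ?(ltW e0) // mulrC ler_pdivrMr ?ltr_wpDl //.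
by rewrite mul1r lerDl.
Unshelve. all: by end_near.
Qed.

Lemma is_gradient_le (l : {scalar E}) (x z : E) (c : R) :
  convex_set Q -> is_gradient Q d x l -> Q x -> Q z ->
  (forall t, 0 < t <= 1 -> d (x + t *: (z - x)) - d x <= t * c) ->
  l (z - x) <= c.
Proof.
move=> Qcvx gradl Qx Qz dc.
apply: (cvgr_to_le (is_gradient_cvg_segment Qcvx gradl Qx Qz)).
near=> t; have t0 : 0 < t by near: t; exact: nbhs_right_gt.
by rewrite ler_pdivrMl // dc // t0 /=; near: t; exact: nbhs_right_le.
Unshelve. all: by end_near.
Qed.

Lemma is_gradient_ge (l : {scalar E}) (x z : E) (c : R) :
  convex_set Q -> is_gradient Q d x l -> Q x -> Q z ->
  (forall t, 0 < t <= 1 -> t * c <= d (x + t *: (z - x)) - d x) ->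
  c <= l (z - x).
Proof.
move=> Qcvx gradl Qx Qz dc.
apply: (cvgr_to_ge (is_gradient_cvg_segment Qcvx gradl Qx Qz)).
near=> t; have t0 : 0 < t by near: t; exact: nbhs_right_gt.
by rewrite ler_pdivlMl // dc // t0 /=; near: t; exact: nbhs_right_le.
Unshelve. all: by end_near.
Qed.

End Gradient.

(** * Bregman divergence and the inequality for one mirror step *)

Section MirrorStep.
Context (R : realType) (E : normedModType R) (Q : set E) (d : E -> R).
Context (nabla_d : E -> {scalar E}).
Hypothesis Qconvex : convex_set Q.
Hypothesis d_grad : forall x, Q x -> is_gradient Q d x (nabla_d x).

Local Notation V := (bregman d nabla_d).

Lemma bregman_ge0 (x y : E) : convex_function Q d -> Q x -> Q y -> 0 <= V y x.
Proof.
move=> d_convex Qx Qy; rewrite subr_ge0.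
apply: (is_gradient_le Qconvex (d_grad Qx) Qx Qy _) => // t /andP[/ltW t0 t1].
by rewrite lerBlDl; apply: (convex_function_segment d_convex); rewrite ?t0.
Qed.

(** First-order optimality: the derivative of [d] at a minimizer is nonnegative towards every point
    of [Q]. *)
Lemma bregman_argmin_le (x y : E) :
  argmin Q d x -> Q y -> V y x <= d y - d x.
Proof.
move=> [Qx dx] Qy; rewrite gerBl.
apply: (is_gradient_ge Qconvex (d_grad Qx) Qx Qy _) => // t /andP[/ltW t0 t1].
by rewrite mulr0 subr_ge0; apply: dx; apply: convex_set_segment; rewrite ?t0.
Qed.

Lemma bregman_three_point (x y z : E) :
  nabla_d y (z - y) - nabla_d x (z - y) = V z x - V y x - V z y.
Proof.
rewrite /bregman; have -> : z - x = (z - y) + (y - x) by rewrite subrKA.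
by rewrite linearD /=; ring.
Qed.

(** Compare [y] with [y + t *: (z - y)]: the increment of [psi] is at most [t] times its endpoint
    difference, and the [nabla_d x] term is exactly linear in [t]. This bounds the increment of [d]
    below by a multiple of [t], and [is_gradient_ge] applies. *)
Lemma Mirr_optimality (psi : E -> E -> R) (h : R) (x y z : E) :
  0 < h -> Q z ->
  convex_function Q (fun u => psi u x) -> Mirr Q d nabla_d h x psi y ->
  h * (psi y x - psi z x) <= nabla_d y (z - y) - nabla_d x (z - y).
Proof.
move=> h0 Qz psi_cvx [Qy miny]; rewrite lerBrDr.
apply: (is_gradient_ge Qconvex (d_grad Qy) Qy Qz _) => // t /andP[/ltW t0 t1].
have t01 : 0 <= t <= 1 by rewrite t0.
have := miny _ (convex_set_segment Qconvex Qy Qz t01).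
have := convex_function_segment psi_cvx Qy Qz t01.
set yt := y + _; rewrite /bregman.
have -> : yt - x = (y - x) + t *: (z - y) by rewrite /yt addrAC.
have -> : nabla_d x ((y - x) + t *: (z - y)) =
    nabla_d x (y - x) + t * nabla_d x (z - y) by rewrite linearD linearZ.
set a := nabla_d x (y - x); set b := nabla_d x (z - y).
move: (psi yt x) (psi y x) (psi z x) (d yt) (d y) (d x) => pt py pz dt dy dx.
move=> /(ler_wpM2l (ltW h0)) pt_le /(ler_wpM2l (ltW h0)).
by rewrite !(mulrDr h) !mulVKf ?gt_eqF //; lra.
Qed.

(** With [h = eps / M ^+ 2] one has [(h * M) ^+ 2 = h * eps], so Young's inequality bounds
    [h * M * s] by [h * eps / 2 + s ^+ 2 / 2]; this is the origin of [eps / 2]. *)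
Lemma Mirr_step (psi : E -> E -> R) (M eps delta : R) (x y z : E) :
  convex_function Q d -> 0 < M -> 0 < eps -> Q x -> Q z ->
  convex_function Q (fun u => psi u x) ->
  - psi y x <= M * Num.sqrt (2 * V y x) + delta ->
  Mirr Q d nabla_d (eps / M ^+ 2) x psi y ->
  eps / M ^+ 2 * (- psi z x - (eps / 2 + delta)) <= V z x - V z y.
Proof.
move=> d_convex M0 eps0 Qx Qz psi_cvx psi_lip miny.
have h0 : 0 < eps / M ^+ 2 by rewrite divr_gt0 // exprn_gt0.
have := Mirr_optimality h0 Qz psi_cvx miny; rewrite bregman_three_point.
have Qy : Q y by case: miny.
have V0 := bregman_ge0 d_convex Qx Qy.
have := psi_lip; rewrite -(ler_pM2l h0).
set s := Num.sqrt _.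
have s2 : s ^+ 2 = 2 * V y x by rewrite sqr_sqrtr // mulr_ge0.
(* Young: the term - s ^+ 2 = - 2 * V y x is absorbed by the three-point
   identity. *)
have : 0 <= (eps / M - s) ^+ 2 := sqr_ge0 _.
have -> : (eps / M - s) ^+ 2 =
    eps / M ^+ 2 * eps - 2 * (eps / M ^+ 2 * (M * s)) + s ^+ 2.
  by field; rewrite gt_eqF.
rewrite s2; set h := eps / M ^+ 2.
move: (psi y x) (psi z x) (V y x) (V z x) (V z y) => p q v v1 v2.
by move: (M * s) h => u h; lra.
Qed.

End MirrorStep.

(** * Summation over a run and the stopping criterion *)

Section AlgorithmC.
Context (R : realType) (E : normedModType R) (A : algC_data E).
Context (f : E -> R) (xstar : E) (x : nat -> E) (n : nat).

Local Notation Q := (dom A).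
Local Notation g := (constr A).
Local Notation d := (ref A).
Local Notation V := (bregman d (grad_ref A)).
Local Notation tol := (eps A + delta A).
Local Notation I := (algC_I A x n).
Local Notation J := (algC_J A x n).

Definition step_size (y : E) : R :=
  if g y <= tol then eps A / Mf A ^+ 2 else eps A / Mg A ^+ 2.

(** Lets both kinds of step share one telescoping sum: in either case [- psi xstar y] bounds it from
    above, at non-productive points because [g xstar <= 0]. *)
Definition step_gap (y : E) : R :=
  if g y <= tol then f y - f xstar else g y.

Hypotheses (Mf_gt0 : 0 < Mf A) (Mg_gt0 : 0 < Mg A) (eps_gt0 : 0 < eps A).

Lemma step_size_gt0 (y : E) : 0 < step_size y.
Proof. by rewrite /step_size; case: ifP => _; rewrite divr_gt0 // exprn_gt0. Qed.

Lemma algC_run_dom : algC_run A x n -> forall k, (k <= n)%N -> Q (x k).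
Proof.
move=> run [_|k kn]; first by have [[]] := run.
have [gk|gk] := leP (g (x k)) tol.
- by have [] := run_productive run kn gk.
- by have [] := run_nonproductive run kn gk.
Qed.

Lemma sum_step_size :
  \sum_(k < n) step_size (x k) =
    eps A * (#|I|%:R / Mf A ^+ 2 + #|J|%:R / Mg A ^+ 2).
Proof.
rewrite (bigID (mem I)) /= mulrDr; congr (_ + _).
- rewrite (eq_bigr (fun=> eps A / Mf A ^+ 2)) => [|k].
    by rewrite sumr_const -[LHS]mulr_natl mulrCA.
  by rewrite inE /step_size => ->.
- rewrite (eq_bigr (fun=> eps A / Mg A ^+ 2)) => [|k].
    rewrite (eq_bigl (mem J)) => [|k]; last by rewrite /= finset.in_setC.
    by rewrite sumr_const -[LHS]mulr_natl mulrCA.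
  by rewrite inE /step_size => /negbTE ->.
Qed.

(** Each iteration adds at least [(Num.max (Mf A) (Mg A)) ^- 2] to the quantity tested by the
    stopping criterion. *)
Lemma natr_le_max_steps :
  n%:R <= Num.max (Mf A) (Mg A) ^+ 2 *
    (#|I|%:R / Mf A ^+ 2 + #|J|%:R / Mg A ^+ 2).
Proof.
have -> : n%:R = #|I|%:R + #|J|%:R :> R.
  by rewrite -natrD /algC_J finset.cardsC card_ord.
have M_le (m k : R) : 0 <= k -> 0 < m -> m <= Num.max (Mf A) (Mg A) ->
    k <= Num.max (Mf A) (Mg A) ^+ 2 * (k / m ^+ 2).
  move=> k0 m0 mM; rewrite mulrCA ler_peMr // ler_pdivlMr ?exprn_gt0 // mul1r.
  by rewrite lerXn2r // nnegrE ltW // (lt_le_trans m0).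
by rewrite mulrDr; apply: lerD; apply: M_le; rewrite ?ler0n // le_max lexx ?orbT.
Qed.

Hypothesis Qconvex : convex_set Q.
Hypothesis d_convex : convex_function Q d.
Hypothesis d_grad : forall y, Q y -> is_gradient Q d y (grad_ref A y).
Hypothesis psif_le : forall y z, Q y -> Q z -> f y + psif A z y <= f z.
Hypothesis psig_le : forall y z, Q y -> Q z -> g y + psig A z y <= g z.
Hypothesis psif_lip : forall y z, Q y -> Q z ->
  - psif A z y <= Mf A * Num.sqrt (2 * V z y) + delta A.
Hypothesis psig_lip : forall y z, Q y -> Q z ->
  - psig A z y <= Mg A * Num.sqrt (2 * V z y) + delta A.
Hypothesis psif_convex : forall y, Q y -> convex_function Q (psif A ^~ y).
Hypothesis psig_convex : forall y, Q y -> convex_function Q (psig A ^~ y).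
Hypotheses (Q_xstar : Q xstar) (g_xstar : g xstar <= 0).
Hypothesis run : algC_run A x n.

Lemma step_gap_le k : (k < n)%N ->
  step_size (x k) * (step_gap (x k) - (eps A / 2 + delta A)) <=
    V xstar (x k) - V xstar (x k.+1).
Proof.
move=> kn; have Qk := algC_run_dom run (ltnW kn).
have Qk1 := algC_run_dom run kn.
have := step_size_gt0 (x k); rewrite /step_gap /step_size.
have [gk|gk] := leP (g (x k)) tol => h0.
- apply: le_trans (Mirr_step Qconvex d_grad d_convex Mf_gt0 eps_gt0 Qk Q_xstar
    (psif_convex Qk) (psif_lip Qk Qk1) (run_productive run kn gk)).
  rewrite ler_pM2l // lerD2r.
  by have := psif_le Qk Q_xstar; lra.
- apply: le_trans (Mirr_step Qconvex d_grad d_convex Mg_gt0 eps_gt0 Qk Q_xstar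
    (psig_convex Qk) (psig_lip Qk Qk1) (run_nonproductive run kn gk)).
  rewrite ler_pM2l // lerD2r.
  by move: g_xstar (psig_le Qk Q_xstar); lra.
Qed.

Lemma sum_step_gap_le :
  \sum_(k < n) step_size (x k) * (step_gap (x k) - (eps A / 2 + delta A)) <=
    d xstar - d (x 0%N).
Proof.
apply: (@le_trans _ _ (\sum_(k < n) (V xstar (x k) - V xstar (x k.+1)))).
  by apply: ler_sum => k _; apply: step_gap_le.
have -> : \sum_(k < n) (V xstar (x k) - V xstar (x k.+1)) =
    V xstar (x 0%N) - V xstar (x n).
  rewrite -(big_mkord xpredT (fun k => V xstar (x k) - V xstar (x k.+1))).
  (* The sign is flipped because the divergences are subtracted in order of increasing index. *)
  rewrite (telescope_sumr_eq (fun k => - V xstar (x k))) // => [|k _].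
    by rewrite opprK addrC.
  by rewrite opprK addrC.
have := bregman_argmin_le Qconvex d_grad (run_start run) Q_xstar.
have := bregman_ge0 Qconvex d_grad d_convex (algC_run_dom run (leqnn n)) Q_xstar.
lra.
Qed.

Hypothesis d_ge0 : forall y, Q y -> 0 <= d y.
Hypothesis d_xstar : d xstar <= Theta0 A ^+ 2.
Hypothesis stop : algC_stop A x n.

Lemma sum_step_gap_tol_le0 :
  \sum_(k < n) step_size (x k) * (step_gap (x k) - tol) <= 0.
Proof.
have dx0 := d_ge0 (algC_run_dom run (leq0n n)).
(* This is the stopping criterion multiplied by [eps A ^+ 2 / 2]. *)
have h_ge : Theta0 A ^+ 2 <= eps A / 2 * \sum_(k < n) step_size (x k).
  rewrite sum_step_size; move: stop; rewrite /algC_stop.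
  set S := _ / _ + _; rewrite ler_pdivrMr ?exprn_gt0 //; lra.
have -> : \sum_(k < n) step_size (x k) * (step_gap (x k) - tol) =
    \sum_(k < n) step_size (x k) * (step_gap (x k) - (eps A / 2 + delta A)) -
    eps A / 2 * \sum_(k < n) step_size (x k).
  by rewrite mulr_sumr -sumrB; apply: eq_bigr => k _; field.
by move: sum_step_gap_le d_xstar; lra.
Qed.

Lemma step_gap_nonproductive (k : 'I_n) :
  k \notin I -> 0 < step_size (x k) * (step_gap (x k) - tol).
Proof.
rewrite inE => gk; rewrite mulr_gt0 ?step_size_gt0 // subr_gt0.
by rewrite /step_gap (negbTE gk) ltNge.
Qed.

(** Otherwise the sum in [sum_step_gap_tol_le0] would be nonempty with only positive terms. This
    makes the averaged output meaningful. *)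
Lemma algC_I_neq0 : (0 < n)%N -> I != finset.set0.
Proof.
move=> n0; apply/negP => /eqP I0.
have gap_gt0 (k : 'I_n) : 0 < step_size (x k) * (step_gap (x k) - tol).
  by apply: step_gap_nonproductive; rewrite I0 inE.
have := sum_step_gap_tol_le0; rewrite leNgt => /negP; apply.
rewrite (bigD1 (Ordinal n0)) //=.
apply: ltr_pwDl; first exact: (gap_gt0 (Ordinal n0)).
by apply: sumr_ge0 => k _; exact: ltW.
Qed.

(** Dropping the positive non-productive terms keeps the sum nonpositive, and the remaining terms
    share one step size, which divides out. *)
Lemma sum_productive_le : \sum_(k in I) f (x k) <= #|I|%:R * (f xstar + tol).
Proof.
have h0 : 0 < eps A / Mf A ^+ 2 by rewrite divr_gt0 // exprn_gt0.
have : \sum_(k in I) (eps A / Mf A ^+ 2 * (f (x k) - (f xstar + tol))) <= 0.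
  apply: le_trans sum_step_gap_tol_le0.
  rewrite [leRHS](bigID (mem I)) /=.
  rewrite [X in _ <= X + _](eq_bigr
      (fun k : 'I_n => eps A / Mf A ^+ 2 * (f (x k) - (f xstar + tol)))).
    rewrite lerDl sumr_ge0 // => k kI.
    by apply: ltW; exact: step_gap_nonproductive.
  move=> k; rewrite inE => gk.
  by rewrite /step_gap /step_size gk (opprD (f xstar)) addrA.
by rewrite -mulr_sumr pmulr_rle0 // sumrB sumr_const subr_le0 mulr_natl.
Qed.

Lemma algC_output_correct : (0 < n)%N ->
  convex_function Q f -> convex_function Q g ->
  let xhat := algC_output A x n in
  [/\ I != finset.set0, Q xhat, f xhat - f xstar <= tol & g xhat <= tol].
Proof.
move=> n0 f_convex g_convex xhat; have I0 := algC_I_neq0 n0.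
have QI (k : 'I_n) : k \in I -> Q (x k).
  by move=> _; exact: (algC_run_dom run (ltnW (ltn_ord k))).
have cI : 0 < #|I|%:R :> R by rewrite ltr0n card_gt0.
have [Qhat fhat] := convex_mean Qconvex f_convex I0 QI.
have [_ ghat] := convex_mean Qconvex g_convex I0 QI.
split=> //.
- rewrite lerBlDl; apply: le_trans fhat _.
  by rewrite ler_pdivrMl //; exact: sum_productive_le.
- apply: le_trans ghat _; rewrite ler_pdivrMl // mulr_natl -sumr_const.
  by apply: ler_sum => k; rewrite inE.
Qed.

End AlgorithmC.

Theorem theorem2p2 (R : realType) (E : normedModType R) (Q : set E)
    (f g d : E -> R) (nabla_d : E -> {scalar E})
    (psi_f psi_g : E -> E -> R)
    (M_f M_g epsilon delta Theta_0 : R) (xstar : E)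
    (hE : finite_dimensional E)
    (Qclosed : closed Q) (Qconvex : convex_set Q)
    (f_subdiff : subdifferentiable Q f) (g_subdiff : subdifferentiable Q g)
    (f_convex : convex_function Q f) (g_convex : convex_function Q g)
    (d_convex : convex_function Q d)
    (d_grad : forall x, Q x -> is_gradient Q d x (nabla_d x))
    (* Theta_0 ^+ 2 must bound d xstar - d x0, which needs 0 <= d x0. *)
    (d_ge0 : forall x, Q x -> 0 <= d x)
    (M_f_gt0 : 0 < M_f) (M_g_gt0 : 0 < M_g)
    (epsilon_gt0 : 0 < epsilon) (delta_gt0 : 0 < delta)
    (psi_f_le : forall x y, Q x -> Q y -> f x + psi_f y x <= f y)
    (psi_f_lip : forall x y, Q x -> Q y ->
      - psi_f y x <= M_f * Num.sqrt (2 * bregman d nabla_d y x) + delta)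
    (psi_g_le : forall x y, Q x -> Q y -> g x + psi_g y x <= g y)
    (psi_g_lip : forall x y, Q x -> Q y ->
      - psi_g y x <= M_g * Num.sqrt (2 * bregman d nabla_d y x) + delta)
    (psi_f_convex : forall x, Q x -> convex_function Q (fun y => psi_f y x))
    (psi_g_convex : forall x, Q x -> convex_function Q (fun y => psi_g y x))
    (psi_f_diag : forall x, Q x -> psi_f x x = 0)
    (psi_g_diag : forall x, Q x -> psi_g x x = 0)
    (xstar_sol : argmin [set x | Q x /\ g x <= 0] f xstar)
    (Theta_0_gt0 : 0 < Theta_0) (d_xstar : d xstar <= Theta_0 ^+ 2) :
  let A := AlgCData Q g d nabla_d psi_f psi_g M_f M_g epsilon delta Theta_0 in
  let M := Num.max M_f M_g in
  (forall (x : nat -> E) (n : nat), algC_stops_at A x n ->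
     let xhat := algC_output A x n in
     [/\ algC_I A x n != finset.set0, Q xhat,
         f xhat - f xstar <= epsilon + delta & g xhat <= epsilon + delta]) /\
  (forall (x : nat -> E) (n : nat), algC_run A x n ->
     n%:Z <= Num.ceil (2 * M ^+ 2 * Theta_0 ^+ 2 / epsilon ^+ 2)).
Proof.
move=> A M.
have [[Q_xstar g_xstar] _] := xstar_sol.
split=> x n.
  case=> n0 run stop.
  exact: (algC_output_correct (A := A) M_f_gt0 M_g_gt0 epsilon_gt0 Qconvex
    d_convex d_grad psi_f_le psi_g_le psi_f_lip psi_g_lip psi_f_convex
    psi_g_convex Q_xstar g_xstar run d_ge0 d_xstar stop).
have M0 : 0 < M by rewrite lt_max M_f_gt0.
set B := _ / _; have B0 : 0 < B by rewrite !(mulr_gt0, invr_gt0, exprn_gt0).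
(* No test precedes the first iteration, so [run_continue] gives nothing for runs of length 0 or 1;
   there [0 < B] suffices. *)
case: n => [|[|n]] run; first by rewrite ceil_ge0; lra.
  by rewrite -gtz0_ge1 ceil_gt0.
(* A run of length [n.+2] failed the test after [n.+1] iterations, and the goal reduces to
   [n.+1%:R < B]. *)
rewrite -addn1 PoszD lezD1 ceil_gt_int -pmulrn.
have /negP : ~ algC_stop A x n.+1 by apply: (run_continue run); rewrite ltnSn.
rewrite -ltNge => nostop.
apply: (le_lt_trans (natr_le_max_steps (A := A) x n.+1 M_f_gt0 M_g_gt0)).
have -> : B = M ^+ 2 * (2 * Theta_0 ^+ 2 / epsilon ^+ 2).
  by rewrite /B; field; rewrite gt_eqF.
by rewrite ltr_pM2l ?exprn_gt0.
Qed.
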